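(* The functor $G$ from $\mathbf{L}$ to $\mathit{Rel}$ is faithful; that is, for all arrow terms $f,g:A\vdash B$ of $\mathbf{L}$ of the same type, if $Gf=Gg$ then $f=g$ in $\mathbf{L}$.
   Context: Formulae: $\mathcal{L}$ is the set of formulae built from infinitely many propositional letters with the binary connectives $\wedge$ and $\vee$; $\xi$ stands for either $\wedge$ or $\vee$. The category $\mathbf{L}$ (the free category with nonempty finite products and coproducts on the set of letters): its objects are the formulae of $\mathcal{L}$. Arrow terms are typed expressions, where $f:A\vdash B$ means that $f$ has source $A$ and target $B$. For all formulae $A,A_1,A_2$ and $i\in\{1,2\}$ the primitive arrow terms are $\mathbf{1}_A:A\vdash A$, $\hat w_A:A\vdash A\wedge A$, $\check w_A:A\vee A\vdash A$, $\hat k^i_{A_1,A_2}:A_1\wedge A_2\vdash A_i$, $\check k^i_{A_1,A_2}:A_i\vdash A_1\vee A_2$. If $f:A\vdash B$ and $g:B\vdash C$ are arrow terms, so is $g\circ f:A\vdash C$; if $f_j:A_j\vdash B_j$ ($j=1,2$) are arrow terms, so is $f_1\mathbin{\xi}f_2:A_1\mathbin{\xi}A_2\vdash B_1\mathbin{\xi}B_2$. The equations of $\mathbf{L}$ are the smallest set of equations between arrow terms of the same type that contains all instances of $f=f$ and of the following, and is closed under symmetry, transitivity and congruence with respect to $\circ$, $\wedge$ and $\vee$ on arrow terms: categorial: $f\circ\mathbf{1}_A=\mathbf{1}_B\circ f=f$ for $f:A\vdash B$, $h\circ(g\circ f)=(h\circ g)\circ f$; bifunctorial: $\mathbf{1}_A\mathbin{\xi}\mathbf{1}_B=\mathbf{1}_{A\xi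 B}$, $(g_1\circ f_1)\mathbin{\xi}(g_2\circ f_2)=(g_1\mathbin{\xi}g_2)\circ(f_1\mathbin{\xi}f_2)$; naturality (for $f:A\vdash B$, $f_j:A_j\vdash B_j$): $(f\wedge f)\circ\hat w_A=\hat w_B\circ f$, $f\circ\check w_A=\check w_B\circ(f\vee f)$, $f_i\circ\hat k^i_{A_1,A_2}=\hat k^i_{B_1,B_2}\circ(f_1\wedge f_2)$, $(f_1\vee f_2)\circ\check k^i_{A_1,A_2}=\check k^i_{B_1,B_2}\circ f_i$; triangular: $\hat k^i_{A,A}\circ\hat w_A=\mathbf{1}_A$, $\check w_A\circ\check k^i_{A,A}=\mathbf{1}_A$, $(\hat k^1_{A,B}\wedge\hat k^2_{A,B})\circ\hat w_{A\wedge B}=\mathbf{1}_{A\wedge B}$, $\check w_{A\vee B}\circ(\check k^1_{A,B}\vee\check k^2_{A,B})=\mathbf{1}_{A\vee B}$. Arrows of $\mathbf{L}$ are equivalence classes of arrow terms modulo these equations; ''$f=g$ in $\mathbf{L}$'' means that $f=g$ is one of these equations. The category $\mathit{Rel}$ and the functor $G$: objects of $\mathit{Rel}$ are the formulae of $\mathcal{L}$; an arrow $R:A\vdash B$ is a binary relation from the set of occurrences of propositional letters in $A$ to the set of occurrences of propositional letters in $B$; composition is $R_2\circ R_1=\{(x,y)\mid\exists z\,(xR_1z\text{ and }zR_2y)\}$, identities are identity relations. Let $|A|$ be the number of letter occurrences in $A$ and $x_j(A)$ the $j$-th one from the left. $R_1\mathbin{\xi}R_2$ is the disjoint union of $R_1$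 and $R_2$ placed side by side: it consists of the pairs $(x_j(A_1\xi A_2),x_k(B_1\xi B_2))$ with $(x_j(A_1),x_k(B_1))\in R_1$ and $(x_{j+|A_1|}(A_1\xi A_2),x_{k+|B_1|}(B_1\xi B_2))$ with $(x_j(A_2),x_k(B_2))\in R_2$. The functor $G:\mathbf{L}\to\mathit{Rel}$ is the identity on objects, preserves identities, $\circ$, $\wedge$, $\vee$, and satisfies: $(x_j(A),x_k(A\wedge A))\in G\hat w_A$ iff $(x_k(A\vee A),x_j(A))\in G\check w_A$ iff $j\equiv k\pmod{|A|}$; $(x_j(A_1\wedge A_2),x_k(A_1))\in G\hat k^1_{A_1,A_2}$ iff $(x_k(A_1),x_j(A_1\vee A_2))\in G\check k^1_{A_1,A_2}$ iff $j=k$; $(x_j(A_1\wedge A_2),x_k(A_2))\in G\hat k^2_{A_1,A_2}$ iff $(x_k(A_2),x_j(A_1\vee A_2))\in G\check k^2_{A_1,A_2}$ iff $j=k+|A_1|$. *)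

(* Defs.v *)
From mathcomp Require Import all_boot.

Set Implicit Arguments.
Unset Strict Implicit.
Unset Printing Implicit Defensive.

Inductive conn : Type := Conj | Disj.

Inductive formula (P : Type) : Type :=
| Letter of P
| Bin of conn & formula P & formula P.

Notation And := (Bin Conj).
Notation Or := (Bin Disj).

(* The paired names hk1/hk2, hw (hatted) and ck1/ck2, cw (checked) are the
   projections and diagonals of the product /\ and the injections and
   codiagonals of the coproduct \/. *)
Inductive arrow (P : Type) : formula P -> formula P -> Type :=
| Id A : arrow A A
| hw A : arrow A (And A A)
| cw A : arrow (Or A A) A
| hk1 A1 A2 : arrow (And A1 A2) A1
| hk2 A1 A2 : arrow (And A1 A2) A2
| ck1 A1 A2 : arrow A1 (Or A1 A2)
| ck2 A1 A2 : arrow A2 (Or A1 A2)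
| Comp A B C (g : arrow B C) (f : arrow A B) : arrow A C
| Par x A1 A2 B1 B2 (f1 : arrow A1 B1) (f2 : arrow A2 B2) :
    arrow (Bin x A1 A2) (Bin x B1 B2).

Arguments hk1 {P} A1 A2.
Arguments hk2 {P} A1 A2.
Arguments ck1 {P} A1 A2.
Arguments ck2 {P} A1 A2.
Arguments Par {P} x {A1 A2 B1 B2} f1 f2.

Declare Scope arrow_scope.
Delimit Scope arrow_scope with arrow.
Bind Scope arrow_scope with arrow.
Local Open Scope arrow_scope.

Notation "g ∘ f" := (Comp g f) (at level 40, left associativity) : arrow_scope.

Reserved Notation "f ≡ g" (at level 70, no associativity).

Inductive eqL (P : Type) :
    forall A B : formula P, arrow A B -> arrow A B -> Prop :=
| eqL_refl A B (f : arrow A B) : f ≡ f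
| eqL_sym A B (f g : arrow A B) : f ≡ g -> g ≡ f
| eqL_trans A B (f g h : arrow A B) : f ≡ g -> g ≡ h -> f ≡ h
| eqL_comp A B C (f f' : arrow A B) (g g' : arrow B C) :
    f ≡ f' -> g ≡ g' -> g ∘ f ≡ g' ∘ f'
| eqL_par x A1 A2 B1 B2 (f1 f1' : arrow A1 B1) (f2 f2' : arrow A2 B2) :
    f1 ≡ f1' -> f2 ≡ f2' -> Par x f1 f2 ≡ Par x f1' f2'
| eqL_idr A B (f : arrow A B) : f ∘ Id A ≡ f
| eqL_idl A B (f : arrow A B) : Id B ∘ f ≡ f
| eqL_assoc A B C D (f : arrow A B) (g : arrow B C) (h : arrow C D) :
    h ∘ (g ∘ f) ≡ (h ∘ g) ∘ f
| eqL_par_id x A B : Par x (Id A) (Id B) ≡ Id (Bin x A B)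
| eqL_par_comp x A1 A2 B1 B2 C1 C2
    (f1 : arrow A1 B1) (f2 : arrow A2 B2)
    (g1 : arrow B1 C1) (g2 : arrow B2 C2) :
    Par x (g1 ∘ f1) (g2 ∘ f2) ≡ Par x g1 g2 ∘ Par x f1 f2
| eqL_hw_nat A B (f : arrow A B) : Par Conj f f ∘ hw A ≡ hw B ∘ f
| eqL_cw_nat A B (f : arrow A B) : f ∘ cw A ≡ cw B ∘ Par Disj f f
| eqL_hk1_nat A1 A2 B1 B2 (f1 : arrow A1 B1) (f2 : arrow A2 B2) :
    f1 ∘ hk1 A1 A2 ≡ hk1 B1 B2 ∘ Par Conj f1 f2
| eqL_hk2_nat A1 A2 B1 B2 (f1 : arrow A1 B1) (f2 : arrow A2 B2) :
    f2 ∘ hk2 A1 A2 ≡ hk2 B1 B2 ∘ Par Conj f1 f2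
| eqL_ck1_nat A1 A2 B1 B2 (f1 : arrow A1 B1) (f2 : arrow A2 B2) :
    Par Disj f1 f2 ∘ ck1 A1 A2 ≡ ck1 B1 B2 ∘ f1
| eqL_ck2_nat A1 A2 B1 B2 (f1 : arrow A1 B1) (f2 : arrow A2 B2) :
    Par Disj f1 f2 ∘ ck2 A1 A2 ≡ ck2 B1 B2 ∘ f2
| eqL_hk1_hw A : hk1 A A ∘ hw A ≡ Id A
| eqL_hk2_hw A : hk2 A A ∘ hw A ≡ Id A
| eqL_cw_ck1 A : cw A ∘ ck1 A A ≡ Id A
| eqL_cw_ck2 A : cw A ∘ ck2 A A ≡ Id A
| eqL_hk_hw A B : Par Conj (hk1 A B) (hk2 A B) ∘ hw (And A B) ≡ Id (And A B)
| eqL_cw_ck A B : cw (Or A B) ∘ Par Disj (ck1 A B) (ck2 A B) ≡ Id (Or A B)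
where "f ≡ g" := (eqL f g) : arrow_scope.

Fixpoint len (P : Type) (A : formula P) : nat :=
  if A is Bin _ A1 A2 then len A1 + len A2 else 1.

(* Letter occurrences are numbered from 0 from the left, so that x_j(A) is the
   ordinal j - 1; the shifts and congruences below are unaffected. *)
Definition rel_hom (P : Type) (A B : formula P) : Type :=
  {set 'I_(len A) * 'I_(len B)}.

Section Rel.
Variable P : Type.
Implicit Types A B C : formula P.

Definition rel_id A : rel_hom A A := [set p | p.1 == p.2].

Definition rel_comp A B C (S : rel_hom B C) (R : rel_hom A B) : rel_hom A C :=
  [set p | [exists z, ((p.1, z) \in R) && ((z, p.2) \in S)]].

Definition rel_par x A1 A2 B1 B2 (R1 : rel_hom A1 B1) (R2 : rel_hom A2 B2) :
    rel_hom (Bin x A1 A2) (Bin x B1 B2) :=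
  [set (lshift (len A2) p.1, lshift (len B2) p.2) | p in R1]
  :|: [set (rshift (len A1) p.1, rshift (len B1) p.2) | p in R2].

Fixpoint G A B (f : arrow A B) : rel_hom A B :=
  match f in arrow A B return rel_hom A B with
  | Id A => rel_id A
  | hw A => [set p : 'I_(len A) * 'I_(len A + len A) | p.1 == p.2 %[mod len A]]
  | cw A => [set p : 'I_(len A + len A) * 'I_(len A) | p.1 == p.2 %[mod len A]]
  | hk1 A1 A2 =>
      [set p : 'I_(len A1 + len A2) * 'I_(len A1) | p.1 == p.2 :> nat]
  | hk2 A1 A2 =>
      [set p : 'I_(len A1 + len A2) * 'I_(len A2) | p.1 == p.2 + len A1 :> nat]
  | ck1 A1 A2 =>
      [set p : 'I_(len A1) * 'I_(len A1 + len A2) | p.2 == p.1 :> nat]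
  | ck2 A1 A2 =>
      [set p : 'I_(len A2) * 'I_(len A1 + len A2) | p.2 == p.1 + len A1 :> nat]
  | Comp _ _ _ g f => rel_comp (G g) (G f)
  | Par x _ _ _ _ f1 f2 => rel_par x (G f1) (G f2)
  end.

End Rel.

(* Main.v *)
Require Import Defs.
From mathcomp Require Import all_boot classical_sets cardinality boolp.
From Stdlib Require Import Setoid Morphisms.

(** Faithfulness of [G] is proved by induction on the source [A] and the target
    [B] of two arrow terms [f] and [g] that link the same occurrences of letters.

    If [B] is a conjunction, [f] and [g] are determined by their two components,
    and if [A] is a disjunction, by their two cocomponents; these have smaller
    types and again link the same occurrences ([faithful_And], [faithful_Or]).

    In the remaining cases cut elimination ([cut_elimination]) tells how a term
    is built at the outside: it is an identity of a letter, or it factors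
    through a projection out of [A] or through an injection into [B]
    ([last_ruleP]).  If [f] and [g] both factor through projections, these are
    the same projection, because no arrow has an empty relation
    ([link_nonempty]), and the induction hypothesis applies to the other factors
    ([via_proj_eq]; [via_inj_eq] for injections).  If [f] factors through a
    projection and [g] through an injection, then all links of [g] start in one
    conjunct of [A].  The key fact is that an arrow with this property factors
    through the corresponding projection ([factor_through_hk]), which brings
    this case back to the case of two projections. *)

Set Implicit Arguments.
Unset Strict Implicit.
Unset Printing Implicit Defensive.

Local Open Scope arrow_scope.

#[local] Hint Resolve eqL_refl : core.

#[local] Instance eqL_equivalence (P : Type) (A B : formula P) :
  Equivalence (@eqL P A B).
Proof.
split; [exact: eqL_refl | exact: eqL_sym | exact: eqL_trans].
Qed.

#[local] Instance Comp_proper (P : Type) (A B C : formula P) :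
  Proper (@eqL P B C ==> @eqL P A B ==> @eqL P A C) (@Comp P A B C).
Proof. by move=> g g' eg f f' ef; apply: eqL_comp. Qed.

#[local] Instance Par_proper (P : Type) x (A1 A2 B1 B2 : formula P) :
  Proper (@eqL P A1 B1 ==> @eqL P A2 B2 ==> @eqL P _ _)
    (@Par P x A1 A2 B1 B2).
Proof. by move=> f f' ef g g' eg; apply: eqL_par. Qed.

(** * Products and coproducts *)

Section Coherence.
Variable P : Type.
Implicit Types A B C D : formula P.

(** [true] selects the first of two components and [false] the second, so that
    one statement about an index [i] covers both projections or injections. *)
Definition pick (i : bool) A1 A2 : formula P := if i then A1 else A2.

Definition hk (i : bool) A1 A2 : arrow (And A1 A2) (pick i A1 A2) :=
  if i return arrow _ (pick i A1 A2) then hk1 A1 A2 else hk2 A1 A2.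

Definition ck (i : bool) A1 A2 : arrow (pick i A1 A2) (Or A1 A2) :=
  if i return arrow (pick i A1 A2) _ then ck1 A1 A2 else ck2 A1 A2.

Definition pair A B1 B2 (f : forall i, arrow A (pick i B1 B2)) :
    arrow A (And B1 B2) :=
  Par Conj (f true) (f false) ∘ hw A.

Definition copair A1 A2 B (f : forall i, arrow (pick i A1 A2) B) :
    arrow (Or A1 A2) B :=
  cw B ∘ Par Disj (f true) (f false).

Lemma hk_pair A B1 B2 (f : forall i, arrow A (pick i B1 B2)) i :
  hk i B1 B2 ∘ pair f ≡ f i.
Proof.
rewrite /pair eqL_assoc; case: i => /=.
  by rewrite -eqL_hk1_nat -eqL_assoc eqL_hk1_hw eqL_idr.
by rewrite -eqL_hk2_nat -eqL_assoc eqL_hk2_hw eqL_idr.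
Qed.

Lemma copair_ck A1 A2 B (f : forall i, arrow (pick i A1 A2) B) i :
  copair f ∘ ck i A1 A2 ≡ f i.
Proof.
rewrite /copair -eqL_assoc; case: i => /=.
  by rewrite eqL_ck1_nat eqL_assoc eqL_cw_ck1 eqL_idl.
by rewrite eqL_ck2_nat eqL_assoc eqL_cw_ck2 eqL_idl.
Qed.

Lemma pair_comp A A' B1 B2 (f : forall i, arrow A (pick i B1 B2))
    (g : arrow A' A) :
  pair f ∘ g ≡ pair (fun i => f i ∘ g).
Proof. by rewrite /pair -eqL_assoc -eqL_hw_nat eqL_assoc -eqL_par_comp. Qed.

Lemma comp_copair A1 A2 B B' (f : forall i, arrow (pick i A1 A2) B)
    (g : arrow B B') :
  g ∘ copair f ≡ copair (fun i => g ∘ f i).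
Proof. by rewrite /copair eqL_assoc eqL_cw_nat -eqL_assoc -eqL_par_comp. Qed.

Lemma pair_congr A B1 B2 (f g : forall i, arrow A (pick i B1 B2)) :
  (forall i, f i ≡ g i) -> pair f ≡ pair g.
Proof. by move=> e; rewrite /pair !e. Qed.

Lemma copair_congr A1 A2 B (f g : forall i, arrow (pick i A1 A2) B) :
  (forall i, f i ≡ g i) -> copair f ≡ copair g.
Proof. by move=> e; rewrite /copair !e. Qed.

Lemma pair_eta A B1 B2 (f : arrow A (And B1 B2)) :
  pair (fun i => hk i B1 B2 ∘ f) ≡ f.
Proof. by rewrite -pair_comp /pair eqL_hk_hw eqL_idl. Qed.

Lemma copair_eta A1 A2 B (f : arrow (Or A1 A2) B) :
  copair (fun i => f ∘ ck i A1 A2) ≡ f.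
Proof. by rewrite -comp_copair /copair eqL_cw_ck eqL_idr. Qed.

(** * Cut elimination *)

(** Composition occurs in these rules only with a projection, an injection, or
    hidden in [pair] and [copair], as in the rules of a sequent calculus without
    cut.  Closure under equality makes being cut-free a property of arrows
    rather than of terms, so that [cut_elimination] can assert it of all. *)
Inductive cutfree : forall A B, arrow A B -> Prop :=
| cutfree_id p : cutfree (Id (Letter p))
| cutfree_hk i A1 A2 B (f : arrow (pick i A1 A2) B) :
    cutfree f -> cutfree (f ∘ hk i A1 A2)
| cutfree_ck i A B1 B2 (f : arrow A (pick i B1 B2)) :
    cutfree f -> cutfree (ck i B1 B2 ∘ f)
| cutfree_pair A B1 B2 (f : forall i, arrow A (pick i B1 B2)) :
    (forall i, cutfree (f i)) -> cutfree (pair f)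
| cutfree_copair A1 A2 B (f : forall i, arrow (pick i A1 A2) B) :
    (forall i, cutfree (f i)) -> cutfree (copair f)
| cutfree_eq A B (f g : arrow A B) : f ≡ g -> cutfree f -> cutfree g.

(** Induction on the derivation of [g].  The source of an arrow is an index of
    [cutfree], so the motive [Q] ranges over all sources and is trivial at those
    that are no disjunction. *)
Lemma cutfree_comp_ck i B1 B2 C (g : arrow (Or B1 B2) C) :
  cutfree g -> cutfree (g ∘ ck i B1 B2).
Proof.
pose Q S C : arrow S C -> Prop :=
  match S return arrow S C -> Prop with
  | Bin Disj B1 B2 => fun g => cutfree (g ∘ ck i B1 B2)
  | _ => fun=> True
  end.
suff H S C' (h : arrow S C') : cutfree h -> Q S C' h by move/H.
elim=> {S C' h} //=.
- move=> j A C1 C2 h _; case: A h => [//|[//|] A1 A2] h /= IH.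
  apply: cutfree_eq (cutfree_ck IH); exact: eqL_assoc.
- move=> A C1 C2 h _; case: A h => [//|[//|] A1 A2] h /= IH.
  apply: cutfree_eq (cutfree_pair IH); by rewrite pair_comp.
- move=> A1 A2 D h Ch _; apply: cutfree_eq (Ch i); by rewrite copair_ck.
- move=> A D h h' e _; case: A h h' e => [//|[//|] A1 A2] h h' e /=.
  apply: cutfree_eq; by rewrite e.
Qed.

(** The motive [Q] is trivial at the sources of [g] that are no conjunction, for
    the same reason as in [cutfree_comp_ck]. *)
Lemma cutfree_comp_pair A B1 B2 (f : forall i, arrow A (pick i B1 B2)) :
    (forall i D (g : arrow (pick i B1 B2) D), cutfree g -> cutfree (g ∘ f i)) ->
  forall C (g : arrow (And B1 B2) C), cutfree g -> cutfree (g ∘ pair f).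
Proof.
move=> cut C g Cg; move: f cut.
pose Q S C : arrow S C -> Prop :=
  match S return arrow S C -> Prop with
  | Bin Conj B1 B2 => fun g => forall f : forall i, arrow A (pick i B1 B2),
    (forall i D (g : arrow (pick i B1 B2) D), cutfree g -> cutfree (g ∘ f i)) ->
    cutfree (g ∘ pair f)
  | _ => fun=> True
  end.
suff H S C' (h : arrow S C') : cutfree h -> Q S C' h by exact: (H _ _ _ Cg).
elim=> {S C' h} //=.
- move=> i A1 A2 D h Ch _ f cut; apply: cutfree_eq (cut i _ _ Ch).
  by rewrite -eqL_assoc hk_pair.
- move=> j S C1 C2 h _; case: S h => [//|[|//] A1 A2] h /= IH f cut.
  apply: cutfree_eq (cutfree_ck (IH f cut)); exact: eqL_assoc.
- move=> S C1 C2 h _; case: S h => [//|[|//] A1 A2] h /= IH f cut.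
  apply: cutfree_eq (cutfree_pair (fun i => IH i f cut)); by rewrite pair_comp.
- move=> S D h h' e _; case: S h h' e => [//|[|//] A1 A2] h h' e /= IH f cut.
  apply: cutfree_eq (IH f cut); by rewrite e.
Qed.

(** Induction on the derivation of [f] alone: whichever rule introduces the
    cut formula on the right of [f], the two preceding lemmas move the cut to
    the premises of that rule, so no induction on the cut formula occurs. *)
Lemma cutfree_comp A B C (f : arrow A B) (g : arrow B C) :
  cutfree f -> cutfree g -> cutfree (g ∘ f).
Proof.
move=> Cf; elim: Cf C g => {A B f}.
- move=> p C g; apply: cutfree_eq; by rewrite eqL_idr.
- move=> i A1 A2 B f _ IH C g /IH /cutfree_hk; apply: cutfree_eq.
  by rewrite eqL_assoc.
- move=> i A B1 B2 f _ IH C g /(cutfree_comp_ck i) /IH; apply: cutfree_eq.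
  by rewrite eqL_assoc.
- by move=> A B1 B2 f _ IH C g; apply: cutfree_comp_pair.
- move=> A1 A2 B f _ IH C g Cg.
  apply: cutfree_eq (cutfree_copair (fun i => IH i C g Cg)).
  by rewrite comp_copair.
- move=> A B f f' e _ IH C g /IH; apply: cutfree_eq; by rewrite e.
Qed.

Lemma cutfree_Id A : cutfree (Id A).
Proof.
elim: A => [p|[] A1 IH1 A2 IH2]; first exact: cutfree_id.
- apply: cutfree_eq (cutfree_pair (f := fun i => Id _ ∘ hk i A1 A2) _).
    rewrite -[X in _ ≡ X]pair_eta; apply: pair_congr => i.
    by rewrite eqL_idl eqL_idr.
  by move=> i; apply: cutfree_hk; case: i.
- apply: cutfree_eq (cutfree_copair (f := fun i => ck i A1 A2 ∘ Id _) _).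
    rewrite -[X in _ ≡ X]copair_eta; apply: copair_congr => i.
    by rewrite eqL_idl eqL_idr.
  by move=> i; apply: cutfree_ck; case: i.
Qed.

Lemma cutfree_proj i A1 A2 : cutfree (hk i A1 A2).
Proof. by apply: cutfree_eq (cutfree_hk (cutfree_Id _)); rewrite eqL_idl. Qed.

Lemma cutfree_inj i A1 A2 : cutfree (ck i A1 A2).
Proof. by apply: cutfree_eq (cutfree_ck (cutfree_Id _)); rewrite eqL_idr. Qed.

Lemma cut_elimination A B (f : arrow A B) : cutfree f.
Proof.
elim: f => {A B}.
- exact: cutfree_Id.
- move=> A; apply: cutfree_eq (cutfree_pair (B1 := A) (B2 := A)
    (f := fun i => if i return arrow A (pick i A A) then Id A else Id A) _).
    by rewrite /pair eqL_par_id eqL_idl.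
  by case; apply: cutfree_Id.
- move=> A; apply: cutfree_eq (cutfree_copair (A1 := A) (A2 := A)
    (f := fun i => if i return arrow (pick i A A) A then Id A else Id A) _).
    by rewrite /copair eqL_par_id eqL_idr.
  by case; apply: cutfree_Id.
- exact: (cutfree_proj true).
- exact: (cutfree_proj false).
- exact: (cutfree_inj true).
- exact: (cutfree_inj false).
- by move=> A B C g Cg f Cf; apply: cutfree_comp.
- case=> A1 A2 B1 B2 f1 C1 f2 C2.
  + apply: cutfree_eq (cutfree_pair
      (f := fun i => (if i return arrow (pick i A1 A2) (pick i B1 B2)
                     then f1 else f2) ∘ hk i A1 A2) _).
      by rewrite /pair eqL_par_comp -eqL_assoc eqL_hk_hw eqL_idr.
    by case; apply: cutfree_hk.
  + apply: cutfree_eq (cutfree_copair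
      (f := fun i => ck i B1 B2 ∘ (if i return arrow (pick i A1 A2) (pick i B1 B2)
                     then f1 else f2)) _).
      by rewrite /copair eqL_par_comp eqL_assoc eqL_cw_ck eqL_idl.
    by case; apply: cutfree_ck.
Qed.

(** Equality on [P] need not be decidable, so an identity whose source and target
    are two provably equal letters is obtained by transport. *)
Definition letter_id (p q : P) (e : p = q) : arrow (Letter p) (Letter q) :=
  ecast r (arrow (Letter p) (Letter r)) e (Id (Letter p)).

Definition via_proj A1 A2 B (f : arrow (And A1 A2) B) : Prop :=
  exists i (h : arrow (pick i A1 A2) B), f ≡ h ∘ hk i A1 A2.

Definition via_inj A B1 B2 (f : arrow A (Or B1 B2)) : Prop :=
  exists i (h : arrow A (pick i B1 B2)), f ≡ ck i B1 B2 ∘ h.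

(** Nothing is asserted when the source is a disjunction or the target a
    conjunction, because the last rule can then be taken to be [copair] or
    [pair]. *)
Definition last_rule A B : arrow A B -> Prop :=
  match A, B return arrow A B -> Prop with
  | Bin Disj _ _, _ | _, Bin Conj _ _ => fun=> True
  | Letter p, Letter q => fun f => exists e : p = q, f ≡ letter_id e
  | Bin Conj A1 A2, Letter q => fun f => via_proj f
  | Letter p, Bin Disj B1 B2 => fun f => via_inj f
  | Bin Conj A1 A2, Bin Disj B1 B2 => fun f => via_proj f \/ via_inj f
  end.

Lemma last_ruleP A B (f : arrow A B) : last_rule f.
Proof.
elim: (cut_elimination f) => {A B f}.
- by move=> p; exists erefl.
- move=> i A1 A2 B f _ _; have: via_proj (f ∘ hk i A1 A2) by exists i, f.
  by case: B f => [q|[] B1 B2] f //; left.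
- move=> i A B1 B2 f _ _; have: via_inj (ck i B1 B2 ∘ f) by exists i, f.
  by case: A f => [p|[] A1 A2] f //; right.
- by move=> [p|[] A1 A2] B1 B2 f.
- by move=> A1 A2 B f.
- move=> A B f g + _; case: A f g => [p|[] A1 A2]; case: B => [q|[] B1 B2] f g e //=.
  + by case=> e' fE; exists e'; rewrite -e.
  + by case=> i [h fE]; exists i, h; rewrite -e.
  + by case=> i [h fE]; exists i, h; rewrite -e.
  + by case=> -[i [h fE]]; [left|right]; exists i, h; rewrite -e.
Qed.

(** * Linked occurrences *)

Fixpoint occ A : Type :=
  if A is Bin _ A1 A2 then (occ A1 + occ A2)%type else unit.

(** The relation [G f], read on occurrences given by their path in the formula
    instead of their rank; sums of types then replace shifts of ordinals. *)
Fixpoint link A B (f : arrow A B) : occ A -> occ B -> Prop :=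
  match f in arrow A B return occ A -> occ B -> Prop with
  | Id A => fun x y => x = y
  | hw A => fun x y => y = inl x \/ y = inr x
  | cw A => fun x y => x = inl y \/ x = inr y
  | hk1 A1 A2 => fun x y => x = inl y
  | hk2 A1 A2 => fun x y => x = inr y
  | ck1 A1 A2 => fun x y => y = inl x
  | ck2 A1 A2 => fun x y => y = inr x
  | Comp _ _ _ g f => fun x y => exists z, link f x z /\ link g z y
  | Par x _ _ _ _ f1 f2 => fun x y =>
      match x, y with
      | inl x, inl y => link f1 x y
      | inr x, inr y => link f2 x y
      | _, _ => False
      end
  end.

Fixpoint rank A : occ A -> 'I_(len A) :=
  match A return occ A -> 'I_(len A) with
  | Letter _ => fun=> ord0
  | Bin _ A1 A2 => fun x =>
      match x with
      | inl y => lshift (len A2) (rank y)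
      | inr y => rshift (len A1) (rank y)
      end
  end.

Lemma rank_inj A : injective (@rank A).
Proof.
elim: A => [p [] []//|c A1 IH1 A2 IH2] [x|x] [y|y] /=.
- by move/lshift_inj/IH1->.
- by move/eqP; rewrite eq_lrshift.
- by move/eqP; rewrite eq_rlshift.
- by move/rshift_inj/IH2->.
Qed.

Lemma rank_surj A (i : 'I_(len A)) : exists x, rank x = i.
Proof.
elim: A i => [p|c A1 IH1 A2 IH2] i /=; first by exists tt; rewrite [i]ord1.
case: (split_ordP i) => j ->.
  by have [x <-] := IH1 j; exists (inl x).
by have [x <-] := IH2 j; exists (inr x).
Qed.

Lemma rank_eq A (x y : occ A) : (rank x == rank y :> nat) <-> x = y.
Proof. by split=> [/eqP/val_inj/rank_inj|->]. Qed.

Lemma mem_G A B (f : arrow A B) x y : (rank x, rank y) \in G f <-> link f x y.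
Proof.
have small C (z : occ C) : rank z %% len C = rank z by apply: modn_small.
elim: f x y => {A B} /=.
- by move=> A x y; rewrite inE /= rank_eq.
- move=> A x y; rewrite inE /= small.
  case: y => y /=; rewrite ?modnDl small rank_eq.
    by split=> [->|[[->]|]] //; left.
  by split=> [->|[|[->]]] //; right.
- move=> A x y; rewrite inE /= small.
  case: x => x /=; rewrite ?modnDl small rank_eq.
    by split=> [->|[[->]|]] //; left.
  by split=> [->|[|[->]]] //; right.
- move=> A1 A2 [x|x] y; rewrite inE /=; first by rewrite rank_eq; split=> [->|[]].
  by split=> // /eqP e; have := ltn_ord (rank y); rewrite -e ltnNge leq_addr.
- move=> A1 A2 [x|x] y; rewrite inE /=.
    by split=> // /eqP e; have := ltn_ord (rank x); rewrite e ltnNge leq_addl.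
  by rewrite addnC eqn_add2r rank_eq; split=> [->|[]].
- move=> A1 A2 x [y|y]; rewrite inE /=; first by rewrite rank_eq; split=> [->|[]].
  by split=> // /eqP e; have := ltn_ord (rank x); rewrite -e ltnNge leq_addr.
- move=> A1 A2 x [y|y]; rewrite inE /=.
    by split=> // /eqP e; have := ltn_ord (rank y); rewrite e ltnNge leq_addl.
  by rewrite addnC eqn_add2r rank_eq; split=> [->|[]].
- move=> A B C g IHg f IHf x y; rewrite inE /=; split.
    case/existsP=> k; have [z <-] := rank_surj k.
    by case/andP=> /IHf fz /IHg gz; exists z.
  case=> z [/IHf fz /IHg gz]; apply/existsP; exists (rank z).
  by rewrite fz gz.
- move=> c A1 A2 B1 B2 f1 IH1 f2 IH2 x y; rewrite inE; split.
    case/orP=> /imsetP[[k l] /=]; have [x' <-] := rank_surj k;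
      have [y' <-] := rank_surj l.
      move/IH1=> xyP [ex ey].
      have -> : x = inl x' by apply: (@rank_inj (Bin c A1 A2)).
      by have -> : y = inl y' by apply: (@rank_inj (Bin c B1 B2)).
    move/IH2=> xyP [ex ey].
    have -> : x = inr x' by apply: (@rank_inj (Bin c A1 A2)).
    by have -> : y = inr y' by apply: (@rank_inj (Bin c B1 B2)).
  case: x y => x [] y //= => [/IH1|/IH2] xyP; apply/orP; [left|right];
    by apply/imsetP; exists (rank x, rank y).
Qed.

(** [G] is well defined on arrows, which allows the links of an arrow to be read
    off from any term equal to it. *)
Lemma link_sound A B (f g : arrow A B) :
  f ≡ g -> forall x y, link f x y <-> link g x y.
Proof.
elim=> {A B f g} /=.
- by [].
- by move=> A B f g _ IH x y; rewrite IH.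
- by move=> A B f g h _ IH1 _ IH2 x y; rewrite IH1.
- by move=> A B C f f' g g' _ IHf _ IHg x y; split=> -[z [/IHf ? /IHg ?]]; exists z.
- by move=> c A1 A2 B1 B2 f1 f1' f2 f2' _ IH1 _ IH2 [x|x] [y|y].
- by move=> A B f x y; split=> [[z [->]]|]; last by exists x.
- by move=> A B f x y; split=> [[z [? <-]]|]; last by exists y.
- move=> A B C D f g h x y; split=> [[z [[w [? ?]] ?]]|[w [? [z [? ?]]]]].
    by exists w; split=> //; exists z.
  by exists z; split=> //; exists w.
- by move=> c A B [x|x] [y|y]; split=> // [->|[]].
- move=> c A1 A2 B1 B2 C1 C2 f1 f2 g1 g2 [x|x] [y|y]; split=> //.
  + by case=> z ?; exists (inl z).
  + by case=> -[z|z] [? ?] //; exists z.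
  + by case=> -[z|z] [].
  + by case=> -[z|z] [].
  + by case=> z ?; exists (inr z).
  + by case=> -[z|z] [? ?] //; exists z.
- move=> A B f x [y|y]; split.
  + by case=> z [[->|->]] // ?; exists y; split=> //; left.
  + by case=> z [? [[->]|]] //; exists (inl x); split=> //; left.
  + by case=> z [[->|->]] // ?; exists y; split=> //; right.
  + by case=> z [? [|[->]]] //; exists (inr x); split=> //; right.
- move=> A B f [x|x] y; split.
  + by case=> z [[[->]|]] // ?; exists (inl y); split=> //; left.
  + by case=> -[z|z] [] // ? [[<-]|] //; exists x; split=> //; left.
  + by case=> z [[|[->]]] // ?; exists (inr y); split=> //; right.
  + by case=> -[z|z] [] // ? [|[<-]] //; exists x; split=> //; right.
- move=> A1 A2 B1 B2 f1 f2 x y; split; first by case=> z [-> ?]; exists (inl y).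
  by case=> z []; case: x => x + zE; rewrite zE //; exists x.
- move=> A1 A2 B1 B2 f1 f2 x y; split; first by case=> z [-> ?]; exists (inr y).
  by case=> z []; case: x => x + zE; rewrite zE //; exists x.
- move=> A1 A2 B1 B2 f1 f2 x y; split; last by case=> z [? ->]; exists (inl x).
  by case=> z [->]; case: y => y // ?; exists y.
- move=> A1 A2 B1 B2 f1 f2 x y; split; last by case=> z [? ->]; exists (inr x).
  by case=> z [->]; case: y => y // ?; exists y.
- move=> A x y; split=> [[z [[]-> []]]|->] //; exists (inl y); split=> //; by left.
- move=> A x y; split=> [[z [[]-> []]]|->] //; exists (inr y); split=> //; by right.
- move=> A x y; split=> [[z [-> [[]|]]]|->] //; exists (inl y); split=> //; by left.
- move=> A x y; split=> [[z [-> [|[]]]]|->] //; exists (inr y); split=> //; by right.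
- move=> A B x y; split.
    by case=> z [[]->]; case: y => y // ->.
  by move=> ->; case: y => y; [exists (inl (inl y))|exists (inr (inr y))];
    split=> //; [left|right].
- move=> A B x y; split.
    by case=> -[z|z] []; case: x => x // -> [[]|[]].
  by move=> ->; case: y => y; [exists (inl (inl y))|exists (inr (inr y))];
    split=> //; [left|right].
Qed.

Definition occ_inj (i : bool) A1 A2 :
    occ (pick i A1 A2) -> (occ A1 + occ A2)%type :=
  if i return occ (pick i A1 A2) -> (occ A1 + occ A2)%type then inl else inr.

Lemma occ_inj_inj i A1 A2 : injective (@occ_inj i A1 A2).
Proof. by case: i => x y []. Qed.

Lemma occ_inj_disjoint i j A1 A2 (x : occ (pick i A1 A2))
    (y : occ (pick j A1 A2)) :
  occ_inj x = occ_inj y -> i = j.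
Proof. by case: i j x y => [] []. Qed.

Lemma link_hk i A1 A2 B (h : arrow (pick i A1 A2) B) x y :
  link (h ∘ hk i A1 A2) x y <-> exists2 z, x = occ_inj z & link h z y.
Proof. by case: i h => h; split=> [[z []]|[z]]; exists z. Qed.

Lemma link_ck i A B1 B2 (h : arrow A (pick i B1 B2)) x y :
  link (ck i B1 B2 ∘ h) x y <-> exists2 z, y = occ_inj z & link h x z.
Proof. by case: i h => h; split=> [[z []]|[z]]; exists z. Qed.

Lemma link_pair A B1 B2 (f : forall i, arrow A (pick i B1 B2)) i x y :
  link (f i) x y -> link (pair f) x (occ_inj y).
Proof.
case: i y => y fxy; [exists (inl x)|exists (inr x)]; split=> //; by [left|right].
Qed.

Lemma link_copair A1 A2 B (f : forall i, arrow (pick i A1 A2) B) i x y :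
  link (f i) x y -> link (copair f) (occ_inj x) y.
Proof.
case: i x => x fxy; [exists (inl y)|exists (inr y)]; split=> //; by [left|right].
Qed.

(** This is where the absence of a terminal and an initial object matters:
    every cut-free derivation contains an axiom, whose two letters are linked. *)
Lemma link_nonempty A B (f : arrow A B) : exists x y, link f x y.
Proof.
elim: (cut_elimination f) => {A B f}.
- by move=> p; exists tt, tt.
- move=> i A1 A2 B f _ [x [y fxy]]; exists (occ_inj x), y.
  by apply/link_hk; exists x.
- move=> i A B1 B2 f _ [x [y fxy]]; exists x, (occ_inj y).
  by apply/link_ck; exists y.
- move=> A B1 B2 f _ /(_ true) [x [y fxy]]; exists x, (occ_inj y).
  exact: link_pair fxy.
- move=> A1 A2 B f _ /(_ true) [x [y fxy]]; exists (occ_inj x), y.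
  exact: link_copair fxy.
- by move=> A B f g e _ [x [y fxy]]; exists x, y; apply/(link_sound e).
Qed.

(** * Faithfulness *)

(** Induction on [B].  For a conjunction, factor both components.  Otherwise look
    at the last rule: an injection is handled by factoring the arrow below it,
    and a projection must be the [i]-th one, as an arrow that factors through
    the other projection has a link, which starts in the other conjunct. *)
Lemma factor_through_hk i A1 A2 B (f : arrow (And A1 A2) B) :
    (forall x y, link f x y -> exists z : occ (pick i A1 A2), x = occ_inj z) ->
  exists h : arrow (pick i A1 A2) B, f ≡ h ∘ hk i A1 A2.
Proof.
have by_proj C (g : arrow (And A1 A2) C) : via_proj g ->
    (forall x y, link g x y -> exists z : occ (pick i A1 A2), x = occ_inj z) ->
    exists h : arrow (pick i A1 A2) C, g ≡ h ∘ hk i A1 A2.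
  case=> j [h gE] only.
  have [x [y hxy]] := link_nonempty h.
  (* A link of [h] gives a link of [g] that starts in the [j]-th conjunct. *)
  have [|z /occ_inj_disjoint ji] := only (occ_inj x) y.
    by apply/(link_sound gE)/link_hk; exists x.
  by rewrite -ji; exists h.
elim: B f => [q|[] B1 IH1 B2 IH2] f only.
- exact: by_proj (last_ruleP f) only.
- have fact j : exists h, hk j B1 B2 ∘ f ≡ h ∘ hk i A1 A2.
    have onlyj x y : link (hk j B1 B2 ∘ f) x y ->
        exists z : occ (pick i A1 A2), x = occ_inj z.
      by case=> z [/only].
    by case: j onlyj => onlyj; [apply: IH1 | apply: IH2].
  have [h1 h1E] := fact true; have [h2 h2E] := fact false.
  exists (pair (fun j => if j return arrow _ (pick j B1 B2) then h1 else h2)).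
  rewrite pair_comp -[f]pair_eta; apply: pair_congr; by case.
- case: (last_ruleP f) => [fP|[j [h fE]]]; first exact: by_proj fP only.
  have [h' h'E] : exists h', h ≡ h' ∘ hk i A1 A2.
    have onlyh x y : link h x y -> exists z : occ (pick i A1 A2), x = occ_inj z.
      move=> hxy; apply: (only x (occ_inj y)).
      by apply/(link_sound fE)/link_ck; exists y.
    by case: j h {fE} onlyh => h onlyh; [apply: IH1 | apply: IH2].
  by exists (ck j B1 B2 ∘ h'); rewrite fE h'E eqL_assoc.
Qed.

Definition same_links A B (f g : arrow A B) : Prop :=
  forall x y, link f x y <-> link g x y.

Definition faithful_at A B : Prop :=
  forall f g : arrow A B, same_links f g -> f ≡ g.

Lemma via_proj_eq A1 A2 B (f g : arrow (And A1 A2) B) :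
    (forall i, faithful_at (pick i A1 A2) B) ->
  via_proj f -> via_proj g -> same_links f g -> f ≡ g.
Proof.
move=> IH [i [f' fE]] [j [g' gE]] fg.
have {}fg : same_links (f' ∘ hk i A1 A2) (g' ∘ hk j A1 A2).
  by move=> x y; rewrite -(link_sound fE) -(link_sound gE).
have ij : i = j.
  have [x [y fxy]] := link_nonempty f'.
  have /fg/link_hk[z /occ_inj_disjoint //] : link (f' ∘ hk i A1 A2) (occ_inj x) y.
  by apply/link_hk; exists x.
case: j / ij g' gE fg => g' gE fg.
rewrite fE gE; suff -> : f' ≡ g' by [].
apply: IH => x y; split=> h.
  have /fg/link_hk[z /occ_inj_inj -> //] : link (f' ∘ hk i A1 A2) (occ_inj x) y.
  by apply/link_hk; exists x.
have /fg/link_hk[z /occ_inj_inj -> //] : link (g' ∘ hk i A1 A2) (occ_inj x) y.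
by apply/link_hk; exists x.
Qed.

Lemma via_inj_eq A B1 B2 (f g : arrow A (Or B1 B2)) :
    (forall i, faithful_at A (pick i B1 B2)) ->
  via_inj f -> via_inj g -> same_links f g -> f ≡ g.
Proof.
move=> IH [i [f' fE]] [j [g' gE]] fg.
have {}fg : same_links (ck i B1 B2 ∘ f') (ck j B1 B2 ∘ g').
  by move=> x y; rewrite -(link_sound fE) -(link_sound gE).
have ij : i = j.
  have [x [y fxy]] := link_nonempty f'.
  have /fg/link_ck[z /occ_inj_disjoint //] : link (ck i B1 B2 ∘ f') x (occ_inj y).
  by apply/link_ck; exists y.
case: j / ij g' gE fg => g' gE fg.
rewrite fE gE; suff -> : f' ≡ g' by [].
apply: IH => x y; split=> h.
  have /fg/link_ck[z /occ_inj_inj -> //] : link (ck i B1 B2 ∘ f') x (occ_inj y).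
  by apply/link_ck; exists y.
have /fg/link_ck[z /occ_inj_inj -> //] : link (ck i B1 B2 ∘ g') x (occ_inj y).
by apply/link_ck; exists y.
Qed.

(** All links of [f], hence of [g], start in the conjunct onto which [f]
    projects. *)
Lemma via_inj_via_proj A1 A2 B1 B2 (f g : arrow (And A1 A2) (Or B1 B2)) :
  via_proj f -> via_inj g -> same_links f g -> via_proj g.
Proof.
case=> i [f' fE] _ fg; exists i; apply: factor_through_hk => x y /fg.
by move/(link_sound fE)/link_hk=> [z -> _]; exists z.
Qed.

Lemma faithful_And A B1 B2 :
  (forall i, faithful_at A (pick i B1 B2)) -> faithful_at A (And B1 B2).
Proof.
move=> IH f g fg; rewrite -[f]pair_eta -[g]pair_eta; apply: pair_congr => i.
by apply: IH => x y; split=> -[z [/fg ? ?]]; exists z.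
Qed.

Lemma faithful_Or A1 A2 B :
  (forall i, faithful_at (pick i A1 A2) B) -> faithful_at (Or A1 A2) B.
Proof.
move=> IH f g fg; rewrite -[f]copair_eta -[g]copair_eta; apply: copair_congr => i.
by apply: IH => x y; split=> -[z [? /fg ?]]; exists z.
Qed.

(** The induction hypotheses lower either [A], with [B] arbitrary, or [B] with [A]
    unchanged, so an induction on [B] inside one on [A] provides them. *)
Lemma faithful A B : faithful_at A B.
Proof.
elim: A B => [p|c A1 IHA1 A2 IHA2] B.
  elim: B => [q|[] B1 IHB1 B2 IHB2].
  - move=> f g _; have [[e fE] [e' gE]] := (last_ruleP f, last_ruleP g).
    (* The transports along [e] and [e'] agree by irrelevance of proofs of
       equations between letters. *)
    by rewrite fE gE (Prop_irrelevance e e').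
  - by apply: faithful_And; case.
  - move=> f g; apply: via_inj_eq; [by case|exact: last_ruleP f|exact: last_ruleP g].
have IHA C i : faithful_at (pick i A1 A2) C by case: i; [apply: IHA1|apply: IHA2].
case: c; last exact: faithful_Or.
elim: B => [q|[] B1 IHB1 B2 IHB2].
- move=> f g; apply: via_proj_eq => //; [exact: last_ruleP f|exact: last_ruleP g].
- by apply: faithful_And; case.
- move=> f g fg; have gf : same_links g f by move=> x y; rewrite fg.
  have IHB i : faithful_at (And A1 A2) (pick i B1 B2) by case: i.
  have [fP gP] := (last_ruleP f, last_ruleP g).
  case: fP gP => fP [] gP.
  + exact: via_proj_eq fg.
  + exact: via_proj_eq (via_inj_via_proj fP gP fg) fg.
  + exact: via_proj_eq (via_inj_via_proj gP fP gf) gP fg.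
  + exact: via_inj_eq fg.
Qed.

End Coherence.

Theorem mainTheorem3 (P : Type) (P_infinite : infinite_set [set: P]%classic)
  (A B : formula P) (f g : arrow A B) : G f = G g -> eqL f g.
Proof. by move=> fg; apply: faithful => x y; rewrite -!mem_G fg. Qed.
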